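(* Let $0 < \alpha < 1$ be a real number and $n$ a positive integer. The points $\{i\alpha\}$, for $0 \le i \le n$, partition the unit interval $[0,1)$ into at most $n+1$ subintervals, the lengths of which take at most three distinct values; when three distinct values occur, one of them is the sum of the other two. More precisely: (1) If $\alpha \in F_n$, then the subintervals of the unit interval divided by the points $\{i\alpha\}$, $0 \le i \le n$, all have the same length. (2) If $\alpha \notin F_n$, let $\frac{a}{b} < \frac{c}{d}$ be the Farey pair in $F_n$ surrounding $\alpha$, i.e. the consecutive elements of $F_n$ (in lowest terms) with $\frac{a}{b} < \alpha < \frac{c}{d}$. Then the unit interval is divided by the points $\{i\alpha\}$, $0 \le i \le n$, into $n+1$ intervals, of which (the three classes below being disjoint and together comprising all $n+1$ intervals) - $n+1-b$ have length $b\alpha - a$, - $n+1-d$ have length $c - d\alpha$, - $b+d-(n+1)$ have length $(b-d)\alpha + c - a$, where the last case occurs when $b+d > n+1$.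
   Context: For real $x$, $\lfloor x \rfloor$ is the largest integer not exceeding $x$ and $\{x\} := x - \lfloor x \rfloor$ is the fractional part. For a positive integer $n$, the Farey sequence $F_n$ consists of the irreducible fractions $\frac{a}{b}$ with integers $0 \le a \le b \le n$, $b\ge 1$, $\gcd(a,b)=1$, arranged in increasing order (so it includes $\frac01$ and $\frac11$). Two consecutive fractions of $F_n$ form a Farey pair. The subintervals into which the points divide the unit interval $[0,1)$ are the half-open intervals (closed on the left, open on the right) whose left endpoint is one of the points and whose right endpoint is the next larger distinct point, or $1$ if there is none (note that $\{0\cdot\alpha\}=0$ is one of the points). *)

(* Defs.v *)
From mathcomp Require Import all_boot all_order all_algebra.
From mathcomp Require Import all_classical reals.

Set Implicit Arguments.
Unset Strict Implicit.
Unset Printing Implicit Defensive.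

Import Order.TTheory GRing.Theory Num.Theory.
Local Open Scope ring_scope.

Definition fracpart (R : realType) (x : R) : R := x - (Num.floor x)%:~R.

(* The distinct values among {i alpha}, 0 <= i <= n, in no particular order. *)
Definition points (R : realType) (alpha : R) (n : nat) : seq R :=
  undup [seq fracpart (i%:R * alpha) | i <- iota 0 n.+1].

(* The minimum over an empty range is 1; since every point is < 1, the default
   value 1 does not interfere when the range is nonempty. *)
Definition next_point (R : realType) (alpha : R) (n : nat) (x : R) : R :=
  \big[Num.min/1]_(y <- points alpha n | x < y) y.

(* The half-open interval [x, y[ is encoded by the pair (x, y). *)
Definition subintervals (R : realType) (alpha : R) (n : nat) : seq (R * R) :=
  [seq (x, next_point alpha n x) | x <- points alpha n].

Definition co_itv (R : realType) (J : R * R) : set R := [set` `[J.1, J.2[].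

Definition len (R : realType) (J : R * R) : R := J.2 - J.1.

(* The fraction a / b is encoded by (a, b), so that lowest terms can be
   expressed on the numerator and the denominator. *)
Definition fraction_val (F : fieldType) (f : nat * nat) : F := f.1%:R / f.2%:R.

Definition farey (n : nat) : seq (nat * nat) :=
  sort (fun f g => fraction_val rat f <= fraction_val rat g)
    [seq f <- [seq (a, b) | b <- iota 1 n, a <- iota 0 b.+1] | coprime f.1 f.2].

Definition in_farey (R : realType) (n : nat) (alpha : R) : Prop :=
  exists2 f, f \in farey n & alpha = fraction_val R f.

Definition farey_pair (n : nat) (f g : nat * nat) : bool :=
  infix [:: f; g] (farey n).

Definition surrounding_farey_pair (R : realType) (n : nat) (alpha : R)
    (p : (nat * nat) * (nat * nat)) : bool :=
  farey_pair n p.1 p.2 && (fraction_val R p.1 < alpha < fraction_val R p.2).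

(* Main.v *)
Require Import Defs.
From mathcomp Require Import all_boot all_order all_algebra.
From mathcomp Require Import all_classical reals.
From mathcomp Require Import zify ring lra.

Set Implicit Arguments.
Unset Strict Implicit.
Unset Printing Implicit Defensive.

(** Everything about the subinterval starting at {i alpha} is decided by the
    numbers L = (l - i) alpha - q with 0 <= l <= n and q an integer: the points
    to the right of {i alpha} lie at such distances, and so does the right end
    1 = {0 alpha} + 1. Hence as soon as a positive L is minimal among all
    positive values of this form, it is the length of the subinterval
    ([next_point_shift]); reaching 1 needs no separate treatment.

    If alpha = a / b with b <= n, every such L is an integer multiple of 1 / b,
    and 1 / b itself is attained because a is invertible modulo b and the
    residues 0, ..., b - 1 are all available as l. So all lengths are 1 / b
    ([next_point_farey]).

    Otherwise let a / b < alpha < c / d be the surrounding Farey pair. The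
    classical facts b c - a d = 1 and b + d > n ([farey_neighbours]) say that
    (b, a) and (d, c) form a basis of the lattice of integer pairs (k, q).
    Writing (k, q) = u (b, a) - v (d, c) gives
      k alpha - q = u (b alpha - a) + v (c - d alpha),
    a combination of two positive reals. For k = l - i the bounds
    -i <= k <= n - i together with b + d > n forbid u and v to have opposite
    signs, so a positive L has u, v >= 0, and the smallest choice depends only
    on i ([gap_length_min]): (u, v) = (1, 0) if i <= n - b, (0, 1) if i >= d, and
    (1, 1) in between. Since n - b < d these three ranges of i are consecutive
    blocks of 0, ..., n, and their sizes are the three multiplicities. The
    global claims on the number of lengths and on the sum relation can be read
    off from this list. *)

Import Order.TTheory GRing.Theory Num.Theory.
Local Open Scope ring_scope.

(** * Fractional parts, points and the subintervals they cut out *)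

Lemma fracpart_itv (R : realType) (x : R) : 0 <= fracpart x < 1.
Proof.
rewrite /fracpart subr_ge0 floor_le_tmp /= ltrBlDr addrC.
by have := floorD1_gt x; rewrite intrD.
Qed.

Lemma fracpart_unique (R : realType) (x y : R) (m : int) :
  0 <= y < 1 -> x = y + m%:~R -> fracpart x = y.
Proof.
move=> /andP[y0 y1] ->; rewrite /fracpart.
have -> : Num.floor (y + m%:~R) = m.
  by apply: floor_def; rewrite intrD; apply/andP; split; lra.
by ring.
Qed.

Lemma mem_points (R : realType) (alpha : R) (n : nat) (x : R) :
  reflect (exists2 i, (i <= n)%N & x = fracpart (i%:R * alpha))
          (x \in points alpha n).
Proof.
rewrite mem_undup; apply: (iffP mapP) => [[i + ->]|[i lin ->]].
  by rewrite mem_iota => /andP[_ lin]; exists i.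
by exists i => //; rewrite mem_iota.
Qed.

Lemma points0 (R : realType) (alpha : R) (n : nat) : 0 \in points alpha n.
Proof.
apply/mem_points; exists 0%N => //; rewrite mul0r.
by rewrite (@fracpart_unique _ _ 0 0) // ?lexx ?ltr01 // addr0.
Qed.

Lemma points_itv (R : realType) (alpha : R) (n : nat) (x : R) :
  x \in points alpha n -> 0 <= x < 1.
Proof. by move=> /mem_points[i _ ->]; exact: fracpart_itv. Qed.

Lemma next_point_le (R : realType) (alpha : R) (n : nat) (x y : R) :
  y \in points alpha n -> x < y -> next_point alpha n x <= y.
Proof. by move=> yP xy; exact: ge_bigmin_seq. Qed.

Lemma next_point_gt (R : realType) (alpha : R) (n : nat) (x : R) :
  x < 1 -> x < next_point alpha n x.
Proof. by move=> x1; exact: lt_bigmin. Qed.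

Lemma next_point_le1 (R : realType) (alpha : R) (n : nat) (x : R) :
  next_point alpha n x <= 1.
Proof. exact: bigmin_le_id. Qed.

(** The hypotheses treat the right end 1 on the same footing as a point, so
    that the last subinterval needs no case distinction later on. *)
Lemma next_pointE (R : realType) (alpha : R) (n : nat) (x z : R) :
  z <= 1 -> (z < 1 -> z \in points alpha n) -> x < z ->
  (forall y, y \in points alpha n -> x < y -> z <= y) ->
  next_point alpha n x = z.
Proof.
move=> z1 zP xz zmin; apply/eqP; rewrite eq_le; apply/andP; split.
  have [/zP zp|] := ltP z 1; first exact: next_point_le.
  by apply: le_trans; exact: next_point_le1.
by rewrite /next_point big_seq_cond; apply: le_bigmin => // y /andP[]; exact: zmin.
Qed.

(** The greatest point not exceeding [z] works: its successor, were it at most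
    [z], would be a point contradicting maximality. *)
Lemma points_pred (R : realType) (alpha : R) (n : nat) (z : R) : 0 <= z < 1 ->
  exists2 x, x \in points alpha n & x <= z < next_point alpha n x.
Proof.
move=> /andP[z0 z1].
set x := \big[Num.max/0]_(y <- points alpha n | y <= z) y.
have xP : x \in points alpha n /\ x <= z.
  rewrite /x big_seq_cond.
  elim/big_ind: _ => [|u v uP vP|y /andP[yP yz]] //; first by rewrite points0.
  by rewrite /Num.max; case: ifP.
exists x; rewrite ?xP.1 // xP.2 /= ltNge; apply/negP => nz.
have nx : x < next_point alpha n x.
  by apply: next_point_gt; exact: le_lt_trans xP.2 z1.
have nP : next_point alpha n x \in points alpha n.
  (* Below the default value 1, the minimum is one of the points. *)
  move: (le_lt_trans nz z1).
  rewrite /next_point big_seq_cond.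
  elim/big_ind: _ => [|u v uP vP|y /andP[yP yz]] //; first by rewrite ltxx.
  by rewrite /Num.min; case: ifP.
by move: nx; rewrite ltNge => /negP; apply; exact: (@le_bigmax_seq _ _ _ _ 0 _ (fun y => y <= z) id).
Qed.

Lemma partition_subintervals (R : realType) (alpha : R) (n : nat) :
  partition [set` subintervals alpha n] (@co_itv R) [set` `[0 : R, 1[].
Proof.
split.
- apply/seteqP; split => z /=.
    move=> [J /= /mapP[x xP ->]].
    rewrite /co_itv /= !in_itv /= => /andP[xz zn].
    have /andP[x0 _] := points_itv xP.
    rewrite (le_trans x0 xz) (lt_le_trans zn) //; exact: next_point_le1.
  rewrite in_itv /= => /points_pred -/(_ alpha n)[x xP xz].
  exists (x, next_point alpha n x); first by apply/mapP; exists x.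
  by rewrite /co_itv /= in_itv.
- move=> J K /= /mapP[x xP ->] /mapP[y yP ->] [z []].
  rewrite /co_itv /= !in_itv /= => /andP[xz zx] /andP[yz zy].
  have [xy|yx|-> //] := ltgtP x y.
  + have := next_point_le yP xy; rewrite leNgt => /negP[].
    exact: le_lt_trans yz zx.
  + have := next_point_le xP yx; rewrite leNgt => /negP[].
    exact: le_lt_trans xz zy.
- move=> J /= /mapP[x xP ->]; exists x.
  rewrite /co_itv /= in_itv /= lexx next_point_gt //.
  by have /andP[] := points_itv xP.
Qed.

(** The points, repeated with period 1, lie to the right of {i alpha} at exactly
    the distances (l - i) alpha - q that are positive. The case [l = 0] covers the distance to the right
    end 1, so minimality of [delta] alone keeps {i alpha} + [delta] in the unit
    interval, where it is either 1 or the point {j alpha}. *)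
Lemma next_point_shift (R : realType) (alpha : R) (n i j : nat) (m : int)
    (delta := (j%:R - i%:R) * alpha - m%:~R) :
  (j <= n)%N -> 0 < delta ->
  (forall (l : nat) (q : int), (l <= n)%N ->
     0 < (l%:R - i%:R) * alpha - q%:~R ->
     delta <= (l%:R - i%:R) * alpha - q%:~R) ->
  next_point alpha n (fracpart (i%:R * alpha)) =
    fracpart (i%:R * alpha) + delta.
Proof.
move=> jn d0 dmin; have /andP[x0 x1] := fracpart_itv (i%:R * alpha).
set x := fracpart _ in x0 x1 *.
pose f := Num.floor (i%:R * alpha).
have xE : x = i%:R * alpha - f%:~R by [].
apply: next_pointE.
- (* 1 - {i alpha} is the distance given by l = 0 and q = - f - 1. *)
  have := dmin 0%N (- f - 1) (leq0n n).
  rewrite intrB intrN => /(_ ltac:(lra)) => h; lra.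
- move=> xd1; apply/mem_points; exists j => //.
  symmetry; apply: (@fracpart_unique _ _ _ (f + m)); first by apply/andP; lra.
  rewrite intrD xE /delta; ring.
- lra.
- move=> _ /mem_points[l ln ->] xl.
  pose g := Num.floor (l%:R * alpha).
  have yE : fracpart (l%:R * alpha) = l%:R * alpha - g%:~R by [].
  have := dmin l (g - f) ln; rewrite intrB.
  move: xl; rewrite yE xE => xl /(_ ltac:(lra)) => h; lra.
Qed.

(** * Farey sequences *)

Lemma mem_farey (n a b : nat) :
  ((a, b) \in farey n) = [&& (0 < b <= n)%N, (a <= b)%N & coprime a b].
Proof.
rewrite mem_sort mem_filter andbC [coprime _ _]/=; apply/idP/idP.
  move=> /andP[/(@allpairsPdep _ (fun=> nat))[b' [a' []]]].
  by rewrite !mem_iota => hb ha [-> ->] ->; lia.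
move=> /and3P[hb ha ->]; rewrite andbT.
by apply/(@allpairsPdep _ (fun=> nat)); exists b, a; rewrite !mem_iota; split=> //; lia.
Qed.

Lemma in_farey_ratio (R : realType) (alpha : R) (n q : nat) (k : int) :
  0 < alpha < 1 -> (0 < q <= n)%N -> q%:R * alpha = k%:~R -> in_farey n alpha.
Proof.
move=> /andP[a0 a1] /andP[q0 qn] qk.
have qR : 0 < q%:R :> R by rewrite ltr0n.
have : 0 <= k%:~R :> R by rewrite -qk; apply: mulr_ge0; lra.
rewrite ler0z; case: k qk => // p qp _.
rewrite -pmulrn in qp.
have pq : (p <= q)%N by rewrite -(ler_nat R) -qp ler_piMr; lra.
pose g := gcdn p q.
have g0 : (0 < g)%N by rewrite gcdn_gt0 q0 orbT.
have [p' pE] := dvdnP (dvdn_gcdl p q : (g %| p)%N).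
have [q' qE] := dvdnP (dvdn_gcdr p q : (g %| q)%N).
exists (p', q').
  rewrite mem_farey; apply/and3P; split; [by nia | by nia |].
  rewrite /coprime -(eqn_pmul2r g0) mul1n muln_gcdl -pE -qE; exact: eqxx.
have gR : g%:R != 0 :> R by rewrite pnatr_eq0 -lt0n.
rewrite /fraction_val /=.
have q'R : q'%:R != 0 :> R by rewrite pnatr_eq0; nia.
apply: (mulIf q'R); rewrite divfK //; apply: (mulIf gR).
by rewrite -natrM -pE -qp qE natrM; ring.
Qed.

Lemma fraction_val_le (F : realFieldType) (f g : nat * nat) :
  (0 < f.2)%N -> (0 < g.2)%N ->
  (fraction_val F f <= fraction_val F g) = (f.1 * g.2 <= g.1 * f.2)%N.
Proof.
move=> f0 g0; rewrite /fraction_val ler_pdivrMr ?ltr0n // mulrAC.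
by rewrite ler_pdivlMr ?ltr0n // -!natrM ler_nat.
Qed.

(** The Bezout equation b x - a y = 1 has a solution with n - b < y <= n, since y
    may be shifted by multiples of b. Then x / y is a fraction of the sequence
    lying just above a / b, at distance 1 / (b y). Were it different from c / d it
    would lie beyond, and the identity
      b (x d - c y) + y (c b - a d) = d (b x - a y) = d
    would force b + y <= d <= n. So x / y = c / d, which gives both conclusions. *)
Lemma farey_neighbours (n a b c d : nat) :
  (a, b) \in farey n -> (c, d) \in farey n -> (a * d < c * b)%N ->
  (forall x y, (x, y) \in farey n -> (x * b <= a * y)%N || (c * y <= x * d)%N) ->
  (b * c = a * d + 1)%N /\ (n < b + d)%N.
Proof.
rewrite !mem_farey => /and3P[hb ab cab] /and3P[hd cd ccd] lt gap.
have b0 : (0 < b)%N by lia.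
have altb : (a < b)%N by nia.
have [x [y [xy /andP[yn ny]]]] :
    exists x y, (b * x = a * y + 1)%N /\ (y <= n < b + y)%N.
  case: (egcdnP a b0) => u v; rewrite gcdnC (eqP cab) => uv _.
  (* Shift (u, v) by multiples of (a, b) so that n - v becomes its residue mod b. *)
  pose r := ((n%:Z - v%:Z) %/ b%:Z)%Z; pose s := ((n%:Z - v%:Z) %% b%:Z)%Z.
  have rs : n%:Z - v%:Z = r * b%:Z + s by exact: divz_eq.
  have s0 : 0 <= s by apply: modz_ge0; lia.
  have sb : s < b%:Z by apply: ltz_pmod; lia.
  have yE : 0 <= v%:Z + r * b%:Z by lia.
  have xy : b%:Z * (u%:Z + r * a%:Z) = a%:Z * (v%:Z + r * b%:Z) + 1.
    rewrite !mulrDr.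
    have -> : b%:Z * u%:Z = a%:Z * v%:Z + 1 by lia.
    ring.
  have xE : 0 <= u%:Z + r * a%:Z by nia.
  exists (absz (u%:Z + r * a%:Z)%R), (absz (v%:Z + r * b%:Z)%R).
  set X := (u%:Z + r * a%:Z) in xE xy *; set Y := (v%:Z + r * b%:Z) in yE xy *.
  by split; [nia | lia].
have y0 : (0 < y)%N by lia.
have cxy : coprime x y.
  apply/coprimeP; first nia.
  by exists (b, a); rewrite /= xy addKn.
have := gap x y; rewrite mem_farey cxy y0 yn /= andbT.
have -> : (x <= y)%N by nia.
move=> /(_ isT) /orP[|cx]; first by nia.
have xd : (x * d = c * y)%N.
  apply/eqP; rewrite eqn_leq cx andbT leqNgt; apply/negP => lt2.
  have bound : (b + y <= d)%N.
    have split_d : (b * (x * d - c * y) + y * (c * b - a * d) = d)%N by nia.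
    by rewrite -split_d leq_add // leq_pmulr // subn_gt0.
  lia.
have yd : y = d.
  apply/eqP; rewrite eqn_dvd -(@Gauss_dvdr y x d) 1?coprime_sym // xd dvdn_mull //=.
  by rewrite -(@Gauss_dvdr d c y) 1?coprime_sym // -xd dvdn_mull.
have xc : x = c by apply/eqP; rewrite -(@eqn_pmul2r d) ?xd ?yd //; lia.
by rewrite -yd -xc.
Qed.

(** A predicate inherited downwards along a sorted sequence cuts it into an
    initial and a final segment. *)
Lemma filter_cat_predC (T : eqType) (r : rel T) (P : pred T) (s : seq T) :
  pairwise r s -> {in s &, forall x y, r x y -> P y -> P x} ->
  s = seq.filter P s ++ seq.filter (predC P) s.
Proof.
elim: s => //= x s IHs /andP[/allP xs srt] down.
have [Px|nPx] /= := boolP (P x).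
  congr (_ :: _); apply: IHs => // y z ys zs.
  by apply: down; rewrite in_cons ?ys ?zs orbT.
have ns : all (predC P) s.
  apply/allP => y ys; apply: contra nPx.
  by apply: down; rewrite ?in_cons ?eqxx ?ys ?orbT //; exact: xs.
rewrite (all_filterP ns).
suff -> : seq.filter P s = [::] by [].
by apply/eqP; rewrite -[_ == _]negbK -has_filter; rewrite -all_predC ns.
Qed.

Lemma farey_pairwise (n : nat) :
  pairwise (fun f g => fraction_val rat f <= fraction_val rat g) (farey n).
Proof.
rewrite -sorted_pairwise; last by move=> g f h; exact: le_trans.
by apply: sort_sorted => f g; exact: le_total.
Qed.

(** The surrounding pair consists of the last element below [alpha] and the
    first one above. This form yields at once its existence, its uniqueness and
    the absence of further elements between its members. *)
Lemma surrounding_farey_pairP (R : realType) (n : nat) (alpha : R)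
    (p : (nat * nat) * (nat * nat))
    (lo := fun f : nat * nat => fraction_val R f < alpha) :
  ~ in_farey n alpha ->
  surrounding_farey_pair n alpha p <->
  exists s t, seq.filter lo (farey n) = rcons s p.1 /\
              seq.filter (predC lo) (farey n) = p.2 :: t.
Proof.
move=> notF.
have split_farey := filter_cat_predC (farey_pairwise n).
have lo_down : {in farey n &, forall f g,
    fraction_val rat f <= fraction_val rat g -> lo g -> lo f}.
  move=> [a b] [c d]; rewrite !mem_farey => /and3P[/andP[b0 _] _ _].
  move=> /and3P[/andP[d0 _] _ _]; rewrite fraction_val_le // -(fraction_val_le R) //.
  exact: le_lt_trans.
rewrite /surrounding_farey_pair /farey_pair; split.
  move=> /andP[/infixP[s [t E]] /andP[plo phi]].
  have pw := farey_pairwise n; rewrite E in pw.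
  have inF f : f \in s ++ [:: p.1; p.2] ++ t -> f \in farey n by rewrite E.
  move: pw; rewrite pairwise_cat /= => /and3P[/allrelP st _].
  move=> /andP[_ /andP[/allP pt _]].
  have slo : all lo s.
    apply/allP => f fs; apply: (lo_down f p.1) => //.
    - by apply: inF; rewrite mem_cat fs.
    - by apply: inF; rewrite mem_cat !inE eqxx orbT.
    - by apply: st => //; rewrite !inE eqxx.
  have thi : all (predC lo) t.
    apply/allP => f ft /=; apply/negP => flo.
    have /(_ _ _ (pt f ft) flo) := lo_down p.2 f.
    rewrite /lo => plo2.
    suff : fraction_val R p.2 < alpha by rewrite ltNge (ltW phi).
    by apply: plo2; apply: inF; rewrite mem_cat !inE ?eqxx ?ft !orbT.
  have phi' : lo p.2 = false by rewrite /lo ltNge (ltW phi).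
  have plo' : lo p.1 by [].
  exists s, t; rewrite E !filter_cat /= plo' phi' /=.
  have tlo : seq.filter lo t = [::].
    by apply/eqP; rewrite -[_ == _]negbK -has_filter -all_predC thi.
  have shi : seq.filter (predC lo) s = [::].
    apply/eqP; rewrite -[_ == _]negbK -has_filter -all_predC.
    by apply/allP => f fs; rewrite /= (allP slo).
  by rewrite (all_filterP slo) (all_filterP thi) tlo shi cats1.
move=> [s [t [Es Et]]].
have : p.1 \in seq.filter lo (farey n) by rewrite Es mem_rcons mem_head.
rewrite mem_filter => /andP[plo _].
have : p.2 \in seq.filter (predC lo) (farey n) by rewrite Et mem_head.
rewrite mem_filter /= => /andP[phi pF].
have -> : fraction_val R p.1 < alpha < fraction_val R p.2.
  rewrite [X in X && _]plo lt_neqAle leNgt phi andbT /=.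
  by apply/eqP => E; apply: notF; exists p.2.
rewrite andbT; apply/infixP; exists s, t.
by rewrite (split_farey lo lo_down) Es Et -cats1 -catA.
Qed.

(** The elements 0 / 1 and 1 / 1 ensure that neither segment is empty. *)
Lemma surrounding_farey_pair_unique_exists (R : realType) (n : nat) (alpha : R) :
  0 < alpha < 1 -> (0 < n)%N -> ~ in_farey n alpha ->
  exists! p, surrounding_farey_pair n alpha p.
Proof.
move=> /andP[a0 a1] n0 notF.
pose lo (f : nat * nat) := fraction_val R f < alpha.
have : (0%N, 1%N) \in seq.filter lo (farey n).
  by rewrite mem_filter mem_farey n0 /lo /fraction_val /= mul0r a0.
have : (1%N, 1%N) \in seq.filter (predC lo) (farey n).
  by rewrite mem_filter mem_farey n0 /lo /fraction_val /= divr1 -leNgt ltW.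
case Et : (seq.filter (predC lo) (farey n)) => [//|g t] _.
case/lastP Es : (seq.filter lo (farey n)) => [//|s f] _.
exists (f, g); split.
  by apply/(surrounding_farey_pairP _ notF); exists s, t.
move=> [f' g'] /(surrounding_farey_pairP _ notF)[s' [t' /=]].
by rewrite -/lo Es Et => -[/rcons_inj[_ ->] [-> _]].
Qed.

Lemma surrounding_farey_pair_det (R : realType) (n : nat) (alpha : R)
    (a b c d : nat) :
  ~ in_farey n alpha -> surrounding_farey_pair n alpha ((a, b), (c, d)) ->
  [/\ (0 < b <= n)%N, (0 < d <= n)%N, (b * c = a * d + 1)%N & (n < b + d)%N].
Proof.
move=> notF sur.
have [/(_ sur)[s [t /= [Es Et]]] _] :=
  surrounding_farey_pairP ((a, b), (c, d)) notF.
set lo := fun _ => _ in Es Et.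
have abF : (a, b) \in farey n.
  suff : (a, b) \in seq.filter lo (farey n) by rewrite mem_filter => /andP[].
  by rewrite Es mem_rcons mem_head.
have cdF : (c, d) \in farey n.
  suff : (c, d) \in seq.filter (predC lo) (farey n) by rewrite mem_filter => /andP[].
  by rewrite Et mem_head.
have /[!mem_farey] /and3P[b0 _ _] := abF.
have /[!mem_farey] /and3P[d0 _ _] := cdF.
have /andP[_ /andP[lo1 hi1]] := sur.
have lt : (a * d < c * b)%N.
  have := lt_trans lo1 hi1; rewrite !ltNge fraction_val_le /=; lia.
have [] := farey_neighbours abF cdF lt; last by split.
move=> x y xyF.
have /[!mem_farey] /and3P[y0 _ _] := xyF.
have pwlo :
    pairwise (fun f g => fraction_val rat f <= fraction_val rat g) (rcons s (a, b)).
  by rewrite -Es; exact: subseq_pairwise (filter_subseq _ _) (farey_pairwise n).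
have pwhi :
    pairwise (fun f g => fraction_val rat f <= fraction_val rat g) ((c, d) :: t).
  by rewrite -Et; exact: subseq_pairwise (filter_subseq _ _) (farey_pairwise n).
have [xlo|xhi] := boolP (lo (x, y)).
  have : (x, y) \in seq.filter lo (farey n) by rewrite mem_filter xlo.
  rewrite Es mem_rcons in_cons => /predU1P[[-> ->]|xs]; first by rewrite leqnn.
  move: pwlo; rewrite pairwise_rcons => /andP[/allP /(_ _ xs) + _].
  by rewrite fraction_val_le /=; lia.
have : (x, y) \in seq.filter (predC lo) (farey n) by rewrite mem_filter /= xhi.
rewrite Et in_cons => /predU1P[[-> ->]|xt]; first by rewrite leqnn orbT.
move: pwhi => /= /andP[/allP /(_ _ xt) + _].
by rewrite fraction_val_le /=; lia.
Qed.

(** * Lengths of the subintervals *)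

Definition gap_length (R : realType) (alpha : R) (n a b c d i : nat) : R :=
  if (i + b <= n)%N then b%:R * alpha - a%:R
  else if (d <= i)%N then c%:R - d%:R * alpha
  else (b%:R - d%:R) * alpha + c%:R - a%:R.

(** Coordinates (u, v) of (l - i, q) in the lattice basis (b, a), - (d, c) turn
    the distance into u (b alpha - a) + v (c - d alpha). Positivity excludes
    u, v <= 0, and |l - i| = |u b - v d| <= n < b + d excludes opposite signs; what
    remains is at least the stated gap, as - i <= l - i <= n - i rules out u = 0
    for i <= n - b, v = 0 for i >= d, and both in between. *)
Lemma gap_length_min (R : realType) (alpha : R) (n a b c d i l : nat) (q : int) :
  (b * c = a * d + 1)%N -> (n < b + d)%N ->
  0 < b%:R * alpha - a%:R -> 0 < c%:R - d%:R * alpha ->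
  (i <= n)%N -> (l <= n)%N -> 0 < (l%:R - i%:R) * alpha - q%:~R ->
  gap_length alpha n a b c d i <= (l%:R - i%:R) * alpha - q%:~R.
Proof.
move=> det nbd D1 D2 lin lln.
pose k : int := l%:Z - i%:Z.
pose u : int := k * c%:Z - q * d%:Z; pose v : int := k * a%:Z - q * b%:Z.
have detZ : b%:Z * c%:Z = a%:Z * d%:Z + 1 by lia.
have kE : k = u * b%:Z - v * d%:Z.
  transitivity (k * (b%:Z * c%:Z - a%:Z * d%:Z)); last by rewrite /u /v; ring.
  by rewrite detZ; ring.
have detR : b%:R * c%:R = a%:R * d%:R + 1 :> R by rewrite -!natrM det natrD.
have LE : (l%:R - i%:R) * alpha - q%:~R =
    u%:~R * (b%:R * alpha - a%:R) + v%:~R * (c%:R - d%:R * alpha).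
  rewrite /u /v /k !intrB !intrM !intrB -!pmulrn.
  transitivity (((l%:R - i%:R) * alpha - q%:~R) * (b%:R * c%:R - a%:R * d%:R)); last by ring.
  by rewrite detR; ring.
rewrite LE.
(* The gap in the same form, with coordinates 0 or 1. *)
have -> : gap_length alpha n a b c d i =
    (~~ ((d <= i) && (n < i + b)))%N%:R * (b%:R * alpha - a%:R) +
    (n < i + b)%N%:R * (c%:R - d%:R * alpha).
  rewrite /gap_length ltnNge; case: leqP => _ /=; rewrite ?andbF ?andbT /=; first by ring.
  by case: leqP => _ /=; ring.
set D := _ - a%:R in D1 *; set E := _ - _ * alpha in D2 *.
have kn : - i%:Z <= k <= n%:Z - i%:Z by rewrite /k; lia.
move=> L0.
have neg (w : int) (h : w <= 0) : w%:~R <= 0 :> R by rewrite lerz0.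
have uv : (0 < u) || (0 < v).
  rewrite -[_ || _]negbK negb_or -!leNgt; apply/negP => /andP[/neg u0 /neg v0].
  move: L0; rewrite ltNge => /negP; apply.
  by rewrite -[leRHS]addr0 lerD // mulr_le0_ge0 // ltW.
have [uD vE] : (~~ ((d <= i) && (n < i + b)))%N%:Z <= u /\ ((n < i + b)%N : nat)%:Z <= v.
  (* A statement about integers only: k = u b - v d lies in [-i, n - i]. *)
  clearbody u v k; clear -kE kn uv lin nbd.
  case: (leqP d i) => hd; case: (ltnP n (i + b)) => hb /=; nia.
apply: lerD; rewrite ler_pM2r //.
  by move: uD; rewrite -(ler_int R).
by move: vE; rewrite -(ler_int R).
Qed.

(** The minimal distance of [gap_length_min] is attained at the index i + b, i - d
    or i + b - d; each of them stays between 0 and n in the range of i that uses it. *)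
Lemma next_point_gap (R : realType) (alpha : R) (n a b c d i : nat) :
  (0 < b <= n)%N -> (0 < d <= n)%N ->
  (b * c = a * d + 1)%N -> (n < b + d)%N ->
  0 < b%:R * alpha - a%:R -> 0 < c%:R - d%:R * alpha -> (i <= n)%N ->
  next_point alpha n (fracpart (i%:R * alpha)) =
    fracpart (i%:R * alpha) + gap_length alpha n a b c d i.
Proof.
move=> hb hd det nbd D1 D2 lin.
have [j [m [jn gE]]] : exists (j : nat) (m : int), (j <= n)%N /\
    gap_length alpha n a b c d i = (j%:R - i%:R) * alpha - m%:~R.
  rewrite /gap_length; case: leqP => hib.
    by exists (i + b)%N, a%:Z; split=> //; rewrite natrD -pmulrn; ring.
  case: leqP => hdi.
    exists (i - d)%N, (- c%:Z); split; first lia.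
    by rewrite natrB // intrN -pmulrn; ring.
  exists (i + b - d)%N, (a%:Z - c%:Z); split; first lia.
  rewrite natrB; last lia.
  by rewrite natrD intrB -!pmulrn; ring.
have gmin := gap_length_min det nbd D1 D2 lin.
rewrite gE; apply: next_point_shift => //.
  rewrite -gE /gap_length; case: ifP => // _; case: ifP => // _.
  have := addr_gt0 D1 D2; congr (0 < _); ring.
by move=> l q ln; rewrite -gE; exact: gmin.
Qed.

(** With alpha = a / b all distances are multiples of 1 / b, and 1 / b is reached
    at the index j < b with (j - i) a = 1 modulo b. *)
Lemma next_point_farey (R : realType) (alpha : R) (n a b i : nat) :
  (0 < b <= n)%N -> coprime a b -> alpha = a%:R / b%:R ->
  next_point alpha n (fracpart (i%:R * alpha)) =
    fracpart (i%:R * alpha) + b%:R^-1.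
Proof.
move=> /andP[b0 bn] cab alphaE.
have bR : 0 < b%:R :> R by rewrite ltr0n.
have bR0 : b%:R != 0 :> R by rewrite gt_eqF.
have [j jb [m jE]] : exists2 j, (j < b)%N & exists m : int, (j%:Z - i%:Z) * a%:Z - m * b%:Z = 1.
  have [u [v uv]] : exists u v : int, u * a%:Z + v * b%:Z = 1.
    have [u [v uv]] := Bezoutz a%:Z b%:Z.
    by exists u, v; rewrite uv /gcdz /= (eqP cab).
  pose s := ((i%:Z + u) %% b%:Z)%Z; pose r := ((i%:Z + u) %/ b%:Z)%Z.
  have rs : i%:Z + u = r * b%:Z + s by exact: divz_eq.
  have s0 : 0 <= s by apply: modz_ge0; lia.
  have sb : s < b%:Z by apply: ltz_pmod; lia.
  exists (absz s); first lia.
  exists (- v - r * a%:Z); rewrite gez0_abs //.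
  have -> : s = i%:Z + u - r * b%:Z by lia.
  rewrite -[RHS]uv; ring.
have cross (x q : int) : x%:~R * alpha - q%:~R = (x * a%:Z - q * b%:Z)%:~R / b%:R.
  by rewrite alphaE intrB !intrM -!pmulrn; field.
have dE : b%:R^-1 = (j%:R - i%:R) * alpha - m%:~R.
  by have := cross (j%:Z - i%:Z) m; rewrite jE intrB -!pmulrn div1r.
rewrite dE; apply: next_point_shift; first lia.
  by rewrite -dE invr_gt0.
move=> l q _; rewrite -dE.
have := cross (l%:Z - i%:Z) q; rewrite intrB -!pmulrn => ->.
rewrite pmulr_lgt0 ?invr_gt0 // ltr0z -[leLHS]mul1r ler_pM2r ?invr_gt0 //.
by rewrite ler1z gtz0_ge1.
Qed.

Lemma subintervals_farey (R : realType) (alpha : R) (n : nat) :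
  in_farey n alpha ->
  {in subintervals alpha n &, forall J K, len J = len K}.
Proof.
move=> [[a b]]; rewrite mem_farey => /and3P[hb _ cab] alphaE.
suff lenE J : J \in subintervals alpha n -> len J = b%:R^-1.
  by move=> J K /lenE -> /lenE ->.
move=> /mapP[_ /mem_points[i _ ->] ->].
by rewrite /len /= (next_point_farey _ hb cab alphaE); ring.
Qed.

(** A coincidence {i alpha} = {j alpha} would write alpha as a fraction with
    denominator j - i <= n. *)
Lemma points_not_farey (R : realType) (alpha : R) (n : nat) :
  0 < alpha < 1 -> ~ in_farey n alpha ->
  points alpha n = [seq fracpart (i%:R * alpha) | i <- iota 0 n.+1].
Proof.
move=> ha notF; apply: undup_id; rewrite map_inj_in_uniq ?iota_uniq //.
suff lt_neq i j : (i < j <= n)%N ->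
    fracpart (i%:R * alpha) <> fracpart (j%:R * alpha).
  move=> i j; rewrite !mem_iota /= => iin jn E.
  have [ij|ji|//] := ltngtP i j; last by case: (lt_neq j i) => //; lia.
  by case: (lt_neq i j) => //; lia.
move=> ijn; rewrite /fracpart => E; apply: notF.
apply: (@in_farey_ratio _ _ _ (j - i)%N
  (Num.floor (j%:R * alpha) - Num.floor (i%:R * alpha)) ha); first lia.
rewrite natrB; last lia.
rewrite intrB mulrBl.
move: E; set fi := (Num.floor _)%:~R; set fj := (Num.floor _)%:~R => E.
by apply/eqP; rewrite subr_eq -(subrK fi (i%:R * alpha)) E; apply/eqP; ring.
Qed.

(** The three classes are the images of the blocks [0, n - b], [d, n] and
    [n - b + 1, d - 1] of indices. *)
Lemma subintervals_not_farey (R : realType) (alpha : R) (n a b c d : nat) :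
  0 < alpha < 1 -> ~ in_farey n alpha ->
  surrounding_farey_pair n alpha ((a, b), (c, d)) ->
  size (subintervals alpha n) = n.+1
  /\ exists I1 I2 I3 : seq (R * R),
    [/\ perm_eq (subintervals alpha n) (I1 ++ I2 ++ I3),
        (size I1)%:Z = n.+1%:Z - b%:Z
        /\ {in I1, forall J, len J = b%:R * alpha - a%:R},
        (size I2)%:Z = n.+1%:Z - d%:Z
        /\ {in I2, forall J, len J = c%:R - d%:R * alpha},
        (size I3)%:Z = (b + d)%:Z - n.+1%:Z
        /\ {in I3, forall J,
              len J = (b%:R - d%:R) * alpha + c%:R - a%:R}
      & I3 <> [::] <-> (n.+1 < b + d)%N].
Proof.
move=> ha notF sur.
have [hb hd det nbd] := surrounding_farey_pair_det notF sur.
have D1 : 0 < b%:R * alpha - a%:R.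
  move: sur => /andP[_ /andP[+ _]]; rewrite /fraction_val /=.
  by rewrite ltr_pdivrMr ?ltr0n 1?mulrC ?subr_gt0 //; lia.
have D2 : 0 < c%:R - d%:R * alpha.
  move: sur => /andP[_ /andP[_]]; rewrite /fraction_val /=.
  by rewrite ltr_pdivlMr ?ltr0n 1?mulrC ?subr_gt0 //; lia.
pose J i := (fracpart (i%:R * alpha), next_point alpha n (fracpart (i%:R * alpha))).
have lenJ i : (i <= n)%N -> len (J i) = gap_length alpha n a b c d i.
  by move=> lin; rewrite /len /= (next_point_gap hb hd det nbd) //; ring.
have sE : subintervals alpha n = [seq J i | i <- iota 0 n.+1].
  by rewrite /subintervals points_not_farey // -map_comp.
split; first by rewrite sE size_map size_iota.
exists [seq J i | i <- iota 0 (n.+1 - b)], [seq J i | i <- iota d (n.+1 - d)],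
  [seq J i | i <- iota (n.+1 - b) (b + d - n.+1)].
have -> : subintervals alpha n = [seq J i | i <- iota 0 (n.+1 - b)] ++
    [seq J i | i <- iota (n.+1 - b) (b + d - n.+1)] ++
    [seq J i | i <- iota d (n.+1 - d)].
  rewrite sE -!map_cat; congr (map _ _).
  set p := (n.+1 - b)%N; set q := (b + d - n.+1)%N; set r := (n.+1 - d)%N.
  have -> : n.+1 = (p + (q + r))%N by lia.
  by rewrite !iotaD add0n; have -> : (p + q)%N = d by lia.
split.
- by rewrite perm_cat2l perm_catC.
- rewrite size_map size_iota; split; first lia.
  move=> _ /mapP[i + ->]; rewrite mem_iota => hi.
  by rewrite lenJ /gap_length; [case: ifP => //; lia | lia].
- rewrite size_map size_iota; split; first lia.
  move=> _ /mapP[i + ->]; rewrite mem_iota => hi.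
  rewrite lenJ /gap_length; last lia.
  by case: ifP => [|_]; first lia; case: ifP => //; lia.
- rewrite size_map size_iota; split; first lia.
  move=> _ /mapP[i + ->]; rewrite mem_iota => hi.
  rewrite lenJ /gap_length; last lia.
  by case: ifP => [|_]; first lia; case: ifP => [|_] //; lia.
- rewrite -subn_gt0; case: (b + d - n.+1)%N => [|k] //; by split.
Qed.

(** The common source of the bound 3 and of the sum relation. In the rational
    case the single length serves as both summands. *)
Lemma subintervals_len_sum (R : realType) (alpha : R) (n : nat) :
  0 < alpha < 1 -> (0 < n)%N ->
  exists x y : R, {subset [seq len J | J <- subintervals alpha n] <= [:: x; y; x + y]}.
Proof.
move=> ha n0; have [inF|notF] := pselect (in_farey n alpha).
  have h := subintervals_farey inF.
  case E : (subintervals alpha n) h => [|J s] h; first by exists 0, 0.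
  exists (len J), (len J) => _ /mapP[K Ks ->].
  by rewrite (h K J) ?mem_head.
have [[[a b] [c d]] [sur _]] := surrounding_farey_pair_unique_exists ha n0 notF.
have [_ [I1 [I2 [I3 [P [_ h1] [_ h2] [_ h3] _]]]]] :=
  subintervals_not_farey ha notF sur.
exists (b%:R * alpha - a%:R), (c%:R - d%:R * alpha) => _ /mapP[J + ->].
rewrite (perm_mem P) !mem_cat !inE => /or3P[/h1|/h2|/h3] ->; rewrite ?eqxx ?orbT //.
by apply/or3P/Or33/eqP; ring.
Qed.

Theorem theorem1 (R : realType) (alpha : R) (n : nat)
    (halpha : 0 < alpha < 1) (hn : (0 < n)%N) :
  [/\ partition [set` subintervals alpha n] (@co_itv R) [set` `[0 : R, 1[],
      (size (subintervals alpha n) <= n.+1)%N,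
      (size (undup [seq len J | J <- subintervals alpha n]) <= 3)%N
    & forall x y z : R,
        uniq [:: x; y; z] ->
        {subset [:: x; y; z] <= [seq len J | J <- subintervals alpha n]} ->
        [\/ x = y + z, y = x + z | z = x + y] ]
  /\ (in_farey n alpha ->
        {in subintervals alpha n &, forall J K, len J = len K})
  /\ (~ in_farey n alpha ->
        (exists! p, surrounding_farey_pair n alpha p)
        /\ forall a b c d : nat,
          surrounding_farey_pair n alpha ((a, b), (c, d)) ->
          size (subintervals alpha n) = n.+1
          /\ exists I1 I2 I3 : seq (R * R),
            [/\ perm_eq (subintervals alpha n) (I1 ++ I2 ++ I3),
                (size I1)%:Z = n.+1%:Z - b%:Z
                /\ {in I1, forall J, len J = b%:R * alpha - a%:R},
                (size I2)%:Z = n.+1%:Z - d%:Z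
                /\ {in I2, forall J, len J = c%:R - d%:R * alpha},
                (size I3)%:Z = (b + d)%:Z - n.+1%:Z
                /\ {in I3, forall J,
                      len J = (b%:R - d%:R) * alpha + c%:R - a%:R}
              & I3 <> [::] <-> (n.+1 < b + d)%N]).
Proof.
have [x0 [y0 sumE]] := subintervals_len_sum halpha hn.
split; last split.
- split.
  + exact: partition_subintervals.
  + rewrite size_map (leq_trans (size_undup _)) //.
    by rewrite size_map size_iota.
  + apply: (@uniq_leq_size _ _ [:: x0; y0; x0 + y0]); first exact: undup_uniq.
    by move=> l; rewrite mem_undup; exact: sumE.
  + move=> x y z; rewrite /= !inE negb_or andbT => /andP[/andP[xy xz] yz] sub.
    have cases l : l \in [:: x; y; z] -> [\/ l = x0, l = y0 | l = x0 + y0].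
      by move=> /sub/sumE; rewrite !inE => /or3P[] /eqP ->; [constructor 1|constructor 2|constructor 3].
    have := cases x; rewrite mem_head => /(_ isT) cx.
    have := cases y; rewrite !inE eqxx orbT => /(_ isT) cy.
    have := cases z; rewrite !inE eqxx !orbT => /(_ isT) cz.
    case: cx cy cz xy xz yz => -> [] -> [] ->; rewrite ?eqxx // => _ _ _;
      by first [constructor 1; ring | constructor 2; ring | constructor 3; ring].
- exact: subintervals_farey.
- move=> notF; split; first exact: surrounding_farey_pair_unique_exists.
  by move=> a b c d; exact: subintervals_not_farey.
Qed.
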